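(* Let $T,\varepsilon,\kappa>0$, $|\rho|<1$ and $\gamma\ge0$. Consider the Riccati terminal value problem on $[0,T]$ $$-h'(t)=2(1-\rho)\gamma h^2(t)-\frac{2\gamma\kappa}{T+\varepsilon-t}h(t)-\frac{(1-\gamma)\kappa^2}{(1-\rho^2)(T+\varepsilon-t)^2},\qquad h(T)=0.$$ It has a solution only if $T<T^*(\gamma)$, where the escape time $T^*(\gamma)$, the constant $\overline\gamma$ and $\Delta=\Delta(\gamma)$ are defined in the context. In particular (for $T<T^*(\gamma)$), if $\gamma>\overline\gamma$, then $\Delta(\gamma)<0$ and the solution is $$h(t)=\frac{\sqrt{-\Delta}\,\tan\Big[\sqrt{-\Delta}\log\big(1+\frac{T-t}{\varepsilon}\big)+\arctan\Big(\frac{1-2\gamma\kappa}{2\sqrt{-\Delta}}\Big)\Big]+\gamma\kappa-\frac12}{2\gamma(1-\rho)(T-t+\varepsilon)}.$$ If $0\le\gamma\le\overline\gamma$, then $\Delta(\gamma)\ge0$ and the solution is $$h(t)=\begin{cases}\displaystyle-\frac{\kappa^2}{1-\rho^2}\Big(\frac1\varepsilon-\frac{1}{T-t+\varepsilon}\Big), & \gamma=0,\\[1em] \displaystyle\frac{\log\big(1+\frac{T-t}{\varepsilon}\big)}{1-(\frac12-\gamma\kappa)\log\big(1+\frac{T-t}{\varepsilon}\big)}\cdot\frac{(\frac12-\gamma\kappa)^2}{2\gamma(1-\rho)(T-t+\varepsilon)}, & \gamma=\overline\gamma,\\[1em] \displaystyle\frac{\big(1+\frac{T-t}{\varepsilon}\big)^{2\sqrt\Delta}-1}{\big(\sqrt\Delta-\frac12+\gamma\kappa\big)\big(1+\frac{T-t}{\varepsilon}\big)^{2\sqrt\Delta}+\sqrt\Delta+\frac12-\gamma\kappa}\cdot\frac{\kappa^2(\gamma-1)}{(1-\rho^2)(T-t+\varepsilon)},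 & 0<\gamma<\overline\gamma.\end{cases}$$ Moreover, if $T^*(\gamma)<+\infty$, then $\lim_{T\to T^*(\gamma)}|h(0;T)|=+\infty$, where $h(\cdot;T)$ denotes the solution with terminal time $T<T^*(\gamma)$.
   Context: $$\overline{\gamma}:=\frac{\sqrt{2\kappa^2+(1-2\kappa)(1+\rho)}}{\sqrt2\,\kappa(1-\rho)}-\frac{1-2\kappa+\rho}{2\kappa(1-\rho)}\ \ (\ge1),\qquad \Delta=\Delta(\gamma):=\frac{\rho-1}{\rho+1}\kappa^2\gamma^2+\Big(\frac{2\kappa}{1+\rho}-1\Big)\kappa\gamma+\frac14.$$ The escape time $T^*(\gamma)\in(0,+\infty]$ is defined by: (i) if $\gamma>\overline\gamma$, $T^*(\gamma)=\varepsilon\Big[\exp\Big(\frac{\pi}{2\sqrt{-\Delta}}-\frac{1}{\sqrt{-\Delta}}\arctan\Big(\frac{1-2\gamma\kappa}{2\sqrt{-\Delta}}\Big)\Big)-1\Big]$; (ii) if $\gamma=\overline\gamma$ and $0<\kappa<\frac12$, $T^*(\gamma)=\varepsilon\Big[\exp\Big(\frac{2}{1-2\gamma\kappa}\Big)-1\Big]$; (iii) if $\gamma\in(1,\overline\gamma)$ and $0<\kappa<\frac12$, $T^*(\gamma)=\varepsilon\Big[\Big(\frac{\frac12-\gamma\kappa+\sqrt\Delta}{\frac12-\gamma\kappa-\sqrt\Delta}\Big)^{\frac{1}{2\sqrt\Delta}}-1\Big]$; (iv) $T^*(\gamma)=+\infty$ for all other values of $\gamma$. *)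

(* Defs.v *)
From Stdlib Require Import Reals ClassicalEpsilon.
From Coquelicot Require Import Coquelicot.
Open Scope R_scope.

Definition gamma_bar (kappa rho : R) : R :=
  sqrt (2 * kappa ^ 2 + (1 - 2 * kappa) * (1 + rho)) / (sqrt 2 * kappa * (1 - rho))
  - (1 - 2 * kappa + rho) / (2 * kappa * (1 - rho)).

Definition riccati_Delta (kappa rho gamma : R) : R :=
  (rho - 1) / (rho + 1) * kappa ^ 2 * gamma ^ 2
  + (2 * kappa / (1 + rho) - 1) * kappa * gamma + 1 / 4.

Definition escape_time (eps kappa rho gamma : R) : Rbar :=
  let gbar := gamma_bar kappa rho in
  let D := riccati_Delta kappa rho gamma in
  if excluded_middle_informative (gamma > gbar) then
    Finite (eps * (exp (PI / (2 * sqrt (- D))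
                        - 1 / sqrt (- D)
                          * atan ((1 - 2 * gamma * kappa) / (2 * sqrt (- D)))) - 1))
  else if excluded_middle_informative (gamma = gbar /\ 0 < kappa < 1 / 2) then
    Finite (eps * (exp (2 / (1 - 2 * gamma * kappa)) - 1))
  else if excluded_middle_informative (1 < gamma < gbar /\ 0 < kappa < 1 / 2) then
    Finite (eps * (Rpower ((1 / 2 - gamma * kappa + sqrt D)
                           / (1 / 2 - gamma * kappa - sqrt D))
                          (1 / (2 * sqrt D)) - 1))
  else p_infty.

(* [D_in] is the derivative relative to [0, T], hence one-sided at 0 and T. *)
Definition riccati_solution (eps kappa rho gamma T : R) (h : R -> R) : Prop :=
  (exists h' : R -> R, forall t, 0 <= t <= T ->
     D_in h h' (fun s => 0 <= s <= T) t /\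
     - h' t = 2 * (1 - rho) * gamma * (h t) ^ 2
              - 2 * gamma * kappa / (T + eps - t) * h t
              - (1 - gamma) * kappa ^ 2 / ((1 - rho ^ 2) * (T + eps - t) ^ 2))
  /\ h T = 0.

Definition is_unique_riccati_solution (eps kappa rho gamma T : R) (f : R -> R) : Prop :=
  forall h : R -> R,
    riccati_solution eps kappa rho gamma T h <->
    (forall t, 0 <= t <= T -> h t = f t).

Definition h_supercritical (eps kappa rho gamma T t : R) : R :=
  let d := sqrt (- riccati_Delta kappa rho gamma) in
  (d * tan (d * ln (1 + (T - t) / eps)
            + atan ((1 - 2 * gamma * kappa) / (2 * d)))
   + gamma * kappa - 1 / 2)
  / (2 * gamma * (1 - rho) * (T - t + eps)).

Definition h_zero (eps kappa rho T t : R) : R :=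
  - (kappa ^ 2 / (1 - rho ^ 2)) * (1 / eps - 1 / (T - t + eps)).

Definition h_critical (eps kappa rho gamma T t : R) : R :=
  let l := ln (1 + (T - t) / eps) in
  l / (1 - (1 / 2 - gamma * kappa) * l)
  * ((1 / 2 - gamma * kappa) ^ 2 / (2 * gamma * (1 - rho) * (T - t + eps))).

Definition h_subcritical (eps kappa rho gamma T t : R) : R :=
  let d := sqrt (riccati_Delta kappa rho gamma) in
  let p := Rpower (1 + (T - t) / eps) (2 * d) in
  (p - 1) / ((d - 1 / 2 + gamma * kappa) * p + d + 1 / 2 - gamma * kappa)
  * (kappa ^ 2 * (gamma - 1) / ((1 - rho ^ 2) * (T - t + eps))).

(* Main.v *)
(** Put a = 1/2 - gamma kappa, u = log (1 + (T - t) / eps) and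
    y = 2 gamma (1 - rho) (T - t + eps) h + a.  For gamma > 0 the problem becomes the autonomous
    equation y' = y^2 - Delta, y(0) = a, in the variable u, which y = - f' / f linearizes to
    f'' = Delta f, f(0) = 1, f'(0) = - a.  For every solution, f' + y f solves a homogeneous
    linear equation and vanishes at u = 0, so it is zero; this gives uniqueness and forces the
    solution to stop before the first positive zero us of f, that is T* = eps (exp us - 1).
    When us exists one has gamma > 1, and the invariant
    f'^2 - Delta f^2 = a^2 - Delta = 2 kappa^2 gamma (gamma - 1) / (1 + rho) > 0
    shows that f'(us) is nonzero, hence h blows up.  The case gamma = 0 is linear. *)
Require Import Defs.
From Stdlib Require Import Reals Lra ClassicalEpsilon.
From Coquelicot Require Import Coquelicot.
Open Scope R_scope.

(** * Uniqueness for homogeneous linear equations *)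

(** With c(m) the minimum of [c] on [0, T], the function w^2 exp(-2 c(m) x) has derivative 2 (c -
    c(m)) w^2 exp(-2 c(m) x) >= 0. It is nonnegative, nondecreasing and zero at [T], hence zero
    throughout; no primitive of [c] is involved. *)
Lemma linear_ode_zero (T : R) (w c : R -> R) :
  (forall t, 0 <= t <= T -> continuous w t) ->
  (forall t, 0 <= t <= T -> continuous c t) ->
  (forall t, 0 < t < T -> is_derive w t (c t * w t)) ->
  w T = 0 ->
  forall t, 0 <= t <= T -> w t = 0.
Proof.
intros Hw Hc Hd HT t Ht.
destruct (continuity_ab_min c 0 T) as [m [Hm _]]; [lra | |].
{ intros x Hx; apply continuity_pt_filterlim, Hc, Hx. }
set (V := fun x => w x ^ 2 * exp (- 2 * c m * x)).
destruct (MVT_gen V t T (fun x => 2 * (c x - c m) * (w x) ^ 2 * exp (- 2 * c m * x)))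
  as [x [Hx HV]].
- rewrite Rmin_left, Rmax_right by lra. intros x Hx. unfold V.
  assert (Hdx := Hd x ltac:(lra)).
  auto_derive; [eexists; exact Hdx |].
  replace (Derive (fun x0 => w x0) x) with (c x * w x)
    by (symmetry; apply is_derive_unique, Hdx). ring.
- rewrite Rmin_left, Rmax_right by lra. intros x Hx. unfold V.
  apply continuity_pt_filterlim.
  apply (continuous_mult (fun x => w x ^ 2) (fun x => exp (- 2 * c m * x))).
  + apply (continuous_comp w (fun z => z ^ 2)); [apply Hw; lra |].
    apply (ex_derive_continuous (fun z => z ^ 2)); auto_derive; trivial.
  + apply (ex_derive_continuous (fun x => exp (- 2 * c m * x))); auto_derive; trivial.
- rewrite Rmin_left, Rmax_right in Hx by lra.
  unfold V in HV; rewrite HT in HV.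
  assert (Hcx := Hm x ltac:(lra)).
  assert (0 <= 2 * (c x - c m) * w x ^ 2 * exp (-2 * c m * x) * (T - t)).
  { assert (Hw2 := pow2_ge_0 (w x)).
    assert (He := exp_pos (- 2 * c m * x)).
    apply Rmult_le_pos; [| lra]. apply Rmult_le_pos; [| lra].
    apply Rmult_le_pos; lra. }
  assert (He := exp_pos (- 2 * c m * t)).
  destruct (Req_dec (w t) 0) as [|Hn]; [assumption | exfalso].
  assert (0 < w t ^ 2) by (apply pow2_gt_0, Hn).
  assert (0 < w t ^ 2 * exp (- 2 * c m * t)) by (apply Rmult_lt_0_compat; lra).
  replace (0 ^ 2) with 0 in HV by ring. lra.
Qed.

(** * One-sided and two-sided derivatives of Riccati solutions *)

Definition riccati_rhs (eps kappa rho gamma T t x : R) : R :=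
  - (2 * (1 - rho) * gamma * x ^ 2
     - 2 * gamma * kappa / (T + eps - t) * x
     - (1 - gamma) * kappa ^ 2 / ((1 - rho ^ 2) * (T + eps - t) ^ 2)).

(* Freezing [h] outside [0, T] turns the one-sided notions into two-sided ones. *)
Lemma riccati_solution_continuous_extension (eps kappa rho gamma T : R) (h : R -> R) :
  0 < T ->
  riccati_solution eps kappa rho gamma T h ->
  exists k : R -> R,
    (forall t, 0 <= t <= T -> k t = h t) /\
    (forall t, 0 <= t <= T -> continuous k t) /\
    (forall t, 0 < t < T -> is_derive k t (riccati_rhs eps kappa rho gamma T t (k t))) /\
    k T = 0.
Proof.
intros HT [[h' Hh] HhT].
(* [cl] is the projection onto [0, T]; it does not increase the distance to a point of the interval,
   so moduli of continuity carry over from [h]. *)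
set (cl := fun t => Rmax 0 (Rmin t T)).
assert (Hcl : forall t, 0 <= t <= T -> cl t = t).
{ intros t Ht; unfold cl; rewrite Rmin_left, Rmax_right; lra. }
assert (Hin : forall t, 0 <= cl t <= T).
{ intros t; unfold cl; split; [apply Rmax_l |].
  apply Rmax_lub; [lra | apply Rmin_r]. }
assert (Hlip : forall t x, 0 <= t <= T -> Rabs (cl x - t) <= Rabs (x - t)).
{ intros t x Ht; unfold cl, Rmin.
  destruct (Rle_dec x T); unfold Rmax; destruct (Rle_dec 0 _);
    apply Rabs_le; destruct (Rle_abs (x - t)), (Rabs_maj2 (x - t)); lra. }
exists (fun t => h (cl t)).
split; [intros t Ht; now rewrite Hcl |].
split; [| split; [| rewrite Hcl; [assumption | lra]]].
- intros t Ht. apply continuity_pt_filterlim.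
  assert (Hc := cont_deriv h h' _ t (proj1 (Hh t Ht))).
  intros e He. destruct (Hc e He) as [d [Hd Hde]].
  exists d; split; [exact Hd |].
  intros x [_ Hx]. simpl in Hde, Hx |- *; unfold Rdist in *.
  rewrite (Hcl t Ht).
  (* The limit behind relative continuity leaves out the point [t] itself, so [cl x = t] is a
     separate case. *)
  destruct (Req_dec (cl x) t) as [-> | Hne].
  + rewrite Rminus_diag, Rabs_R0; exact He.
  + apply Hde. split; [split; [apply Hin | now apply not_eq_sym] |].
    eapply Rle_lt_trans; [apply Hlip, Ht | exact Hx].
- intros t Ht.
  destruct (Hh t ltac:(lra)) as [HD Heq].
  rewrite (Hcl t) by lra.
  replace (riccati_rhs eps kappa rho gamma T t (h t)) with (h' t)
    by (unfold riccati_rhs; rewrite <- Heq; ring).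
  apply is_derive_ext_loc with h.
  + assert (Hr : 0 < Rmin t (T - t)) by (apply Rmin_pos; lra).
    exists (mkposreal _ Hr). intros x Hx.
    rewrite Hcl; [reflexivity |].
    assert (Hx' : Rabs (x - t) < Rmin t (T - t)) by exact Hx.
    assert (H1 := Rmin_l t (T - t)). assert (H2 := Rmin_r t (T - t)).
    apply Rabs_lt_between in Hx'. lra.
  + apply is_derive_Reals, derivable_pt_lim_D_in.
    intros e He. destruct (HD e He) as [d [Hd Hde]].
    (* The radius also keeps [x] inside [0, T], where the relative derivative says something. *)
    assert (Hr : 0 < Rmin d (Rmin t (T - t))) by (repeat apply Rmin_pos; lra).
    exists (Rmin d (Rmin t (T - t))). split; [exact Hr |].
    intros x [[_ Hxt] Hx]. simpl in Hde, Hx |- *; unfold Rdist in *.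
    assert (H0 := Rmin_l d (Rmin t (T - t))).
    assert (H3 := Rmin_r d (Rmin t (T - t))).
    assert (H1 := Rmin_l t (T - t)). assert (H2 := Rmin_r t (T - t)).
    apply Hde. split; [split; [| exact Hxt] | lra].
    assert (Hx' : Rabs (x - t) < Rmin t (T - t)) by lra.
    apply Rabs_lt_between in Hx'. lra.
Qed.

(** [D_in] compares values inside [0, T] only, so [h] inherits the relative derivative of [F]
    whatever it does outside. *)
Lemma riccati_solution_of_is_derive (eps kappa rho gamma T : R) (h F : R -> R) :
  0 <= T ->
  (forall t, 0 <= t <= T -> is_derive F t (riccati_rhs eps kappa rho gamma T t (F t))) ->
  F T = 0 ->
  (forall t, 0 <= t <= T -> h t = F t) ->
  riccati_solution eps kappa rho gamma T h.
Proof.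
intros HT HF HFT Heq.
split; [| rewrite Heq; [assumption | lra]].
exists (fun t => riccati_rhs eps kappa rho gamma T t (F t)).
intros t Ht. split.
- assert (HD := proj2 (derivable_pt_lim_D_in F
    (fun t => riccati_rhs eps kappa rho gamma T t (F t)) t)
    (proj1 (is_derive_Reals _ _ _) (HF t Ht))).
  intros e He. destruct (HD e He) as [d [Hd Hde]].
  exists d; split; [exact Hd |].
  intros x [[Hx Hxt] Hxd].
  rewrite (Heq t Ht), (Heq x Hx).
  apply Hde. split; [split; [exact I | exact Hxt] | exact Hxd].
- rewrite (Heq t Ht). unfold riccati_rhs. ring.
Qed.

(** * Linearization of the Riccati equation *)

(* [f] solves the linear equation [f'' = D f] associated with [y' = y^2 - D],
   [y 0 = a] through [y = - f' / f]. *)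
Definition riccati_linearization (a D : R) (f g : R -> R) : Prop :=
  (forall u, is_derive f u (g u)) /\
  (forall u, is_derive g u (D * f u)) /\
  f 0 = 1 /\ g 0 = - a.

(** With a = 1/2 - gamma kappa this gives a^2 - Delta, which for gamma, kappa > 0 has the sign of
    gamma - 1. The later sign discussions rest on it. *)
Lemma riccati_Delta_square (kappa rho gamma : R) :
  -1 < rho ->
  riccati_Delta kappa rho gamma
  = (1 / 2 - gamma * kappa) ^ 2 + 2 * kappa ^ 2 * gamma * (1 - gamma) / (1 + rho).
Proof. intros H; unfold riccati_Delta; field; lra. Qed.

(* With [y = 2 gamma (1 - rho) (T + eps - t) h + a] the left-hand side is [f' + y f],
   which solves a homogeneous linear equation and vanishes at [T]. *)
Lemma riccati_solution_linearized (eps kappa rho gamma T : R) (f g h : R -> R) :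
  0 < eps -> -1 < rho < 1 -> 0 < T ->
  riccati_linearization (1 / 2 - gamma * kappa) (riccati_Delta kappa rho gamma) f g ->
  riccati_solution eps kappa rho gamma T h ->
  forall t, 0 <= t <= T ->
  let u := ln (1 + (T - t) / eps) in
  g u + (2 * gamma * (1 - rho) * (T - t + eps) * h t + (1 / 2 - gamma * kappa)) * f u = 0.
Proof.
intros Heps Hrho HT [Hf [Hg [Hf0 Hg0]]] Hh t Ht.
destruct (riccati_solution_continuous_extension _ _ _ _ _ _ HT Hh)
  as [k [Hkh [Hkc [Hkd HkT]]]].
simpl. rewrite <- (Hkh t Ht).
set (a := 1 / 2 - gamma * kappa) in *.
set (y := fun t => 2 * gamma * (1 - rho) * (T - t + eps) * k t + a).
set (u := fun t => ln (1 + (T - t) / eps)).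
assert (Hpos : forall x, x <= T -> 0 < 1 + (T - x) / eps).
{ intros x Hx. assert (0 <= (T - x) / eps) by (apply Rdiv_le_0_compat; lra). lra. }
assert (Hu : forall x, x <= T -> is_derive u x (- / (T - x + eps))).
{ intros x Hx. unfold u. assert (Hp := Hpos x Hx).
  auto_derive; [exact Hp |]. field. lra. }
assert (Hfu : forall x, x <= T -> is_derive (fun x => f (u x)) x (- / (T - x + eps) * g (u x))).
{ intros x Hx. apply (is_derive_comp f u x); [apply Hf | apply Hu, Hx]. }
assert (Hgu : forall x, x <= T -> is_derive (fun x => g (u x)) x
    (- / (T - x + eps) * (riccati_Delta kappa rho gamma * f (u x)))).
{ intros x Hx. apply (is_derive_comp g u x); [apply Hg | apply Hu, Hx]. }
assert (Hyc : forall x, 0 <= x <= T -> continuous y x).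
{ intros x Hx. unfold y.
  apply (continuous_plus (fun t => 2 * gamma * (1 - rho) * (T - t + eps) * k t) (fun _ => a));
    [| apply continuous_const].
  apply (continuous_mult (fun t => 2 * gamma * (1 - rho) * (T - t + eps)) k);
    [| apply Hkc, Hx].
  apply (ex_derive_continuous (fun t => 2 * gamma * (1 - rho) * (T - t + eps))).
  auto_derive; trivial. }
change (g (u t) + y t * f (u t) = 0).
apply (linear_ode_zero T (fun t => g (u t) + y t * f (u t))
         (fun t => - / (T - t + eps) * y t)); [| | | | exact Ht].
- intros x Hx.
  apply (continuous_plus (fun t => g (u t)) (fun t => y t * f (u t))).
  + apply (ex_derive_continuous (fun t => g (u t))). eexists; apply Hgu; lra.
  + apply (continuous_mult y (fun t => f (u t))); [apply Hyc, Hx |].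
    apply (ex_derive_continuous (fun t => f (u t))). eexists; apply Hfu; lra.
- intros x Hx.
  apply (continuous_mult (fun t => - / (T - t + eps)) y); [| apply Hyc, Hx].
  apply (ex_derive_continuous (fun t => - / (T - t + eps))).
  auto_derive. lra.
- intros x Hx.
  assert (Hyd : is_derive y x
    (- 2 * gamma * (1 - rho) * k x
     + 2 * gamma * (1 - rho) * (T - x + eps) * riccati_rhs eps kappa rho gamma T x (k x))).
  { unfold y. assert (Hk := Hkd x Hx).
    auto_derive; [eexists; exact Hk |].
    replace (Derive (fun x0 => k x0) x)
      with (riccati_rhs eps kappa rho gamma T x (k x))
      by (symmetry; apply is_derive_unique, Hk). ring. }
  (* Since y' = -(y^2 - Delta) / (T - x + eps), the two terms in Delta f cancel in the product rule
     and y (g + y f) can be factored out. *)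
  replace (- / (T - x + eps) * y x * (g (u x) + y x * f (u x))) with
    (- / (T - x + eps) * (riccati_Delta kappa rho gamma * f (u x))
     + ((- 2 * gamma * (1 - rho) * k x
     + 2 * gamma * (1 - rho) * (T - x + eps) * riccati_rhs eps kappa rho gamma T x (k x))
        * f (u x) + y x * (- / (T - x + eps) * g (u x)))).
  + apply (is_derive_plus (fun t => g (u t)) (fun t => y t * f (u t))); [apply Hgu; lra |].
    apply (is_derive_mult y (fun t => f (u t))); [exact Hyd | apply Hfu; lra |].
    intros; apply Rmult_comm.
  + rewrite riccati_Delta_square by lra. fold a. unfold y, riccati_rhs, a.
    field. repeat split; try lra; nra.
- unfold u, y. rewrite HkT. replace (1 + (T - T) / eps) with 1 by (field; lra).
  rewrite ln_1, Hf0, Hg0. ring.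
Qed.

(** Where [f] is nonzero, g + y f = 0 can be solved for [h], which gives uniqueness; conversely -g/f
    satisfies y' = y^2 - Delta in u. Each closed form for gamma > 0 is thereby reduced to an
    algebraic identity. *)
Lemma is_unique_riccati_solution_linearized (eps kappa rho gamma T : R) (f g F : R -> R) :
  0 < eps -> -1 < rho < 1 -> 0 < T -> 0 < gamma ->
  riccati_linearization (1 / 2 - gamma * kappa) (riccati_Delta kappa rho gamma) f g ->
  (forall t, 0 <= t <= T -> f (ln (1 + (T - t) / eps)) <> 0) ->
  (forall t, 0 <= t <= T ->
     let u := ln (1 + (T - t) / eps) in
     F t = (- g u / f u - (1 / 2 - gamma * kappa)) / (2 * gamma * (1 - rho) * (T - t + eps))) ->
  is_unique_riccati_solution eps kappa rho gamma T F.
Proof.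
intros Heps Hrho HT Hgam Hlin Hf0 HF h. split.
- intros Hh t Ht. rewrite (HF t Ht).
  assert (H := riccati_solution_linearized _ _ _ _ _ _ _ _ Heps Hrho HT Hlin Hh t Ht).
  simpl in H. specialize (Hf0 t Ht).
  set (u := ln (1 + (T - t) / eps)) in *.
  simpl. replace (g u) with
    (- (2 * gamma * (1 - rho) * (T - t + eps) * h t + (1 / 2 - gamma * kappa)) * f u) by lra.
  field. repeat split; lra.
- intros Heq.
  destruct Hlin as [Hf [Hg [Hf1 Hg1]]].
  (* [F] is known on [0, T] only, whereas a two-sided derivative needs a neighbourhood; hence the
     explicit quotient. *)
  apply riccati_solution_of_is_derive with
    (F := fun t => (- g (ln (1 + (T - t) / eps)) / f (ln (1 + (T - t) / eps))
       - (1 / 2 - gamma * kappa)) / (2 * gamma * (1 - rho) * (T - t + eps))).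
  + lra.
  + intros t Ht.
    assert (Hp : 0 < 1 + (T - t) / eps).
    { assert (0 <= (T - t) / eps) by (apply Rdiv_le_0_compat; lra). lra. }
    specialize (Hf0 t Ht).
    assert (Hfu := Hf (ln (1 + (T - t) / eps))).
    assert (Hgu := Hg (ln (1 + (T - t) / eps))).
    assert (2 * gamma * (1 - rho) * (T - t + eps) <> 0).
    { apply Rgt_not_eq; repeat apply Rmult_lt_0_compat; lra. }
    auto_derive.
    * repeat split; trivial; eexists; eassumption.
    * set (u := ln (1 + (T - t) / eps)) in *.
      change (ln (1 + (T + - t) * / eps)) with u.
      replace (Derive (fun x => f x) u) with (g u)
        by (symmetry; apply is_derive_unique, Hfu).
      replace (Derive (fun x => g x) u) with (riccati_Delta kappa rho gamma * f u)
        by (symmetry; apply is_derive_unique, Hgu).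
      rewrite riccati_Delta_square by lra. unfold riccati_rhs.
      field. repeat split; try lra; nra.
  + replace (1 + (T - T) / eps) with 1 by (field; lra).
    rewrite ln_1, Hf1, Hg1. field. split; lra.
  + intros t Ht. rewrite (Heq t Ht). apply HF, Ht.
Qed.

(** * The threshold [gamma_bar] and the sign of Delta *)

(** Over the common denominator 2 kappa (1 - rho) the numerator is sqrt(2 W) - (1 - 2 kappa + rho),
    and 2 W - (1 - 2 kappa + rho)^2 = 1 - rho^2 > 0. *)
Lemma gamma_bar_pos (kappa rho : R) :
  0 < kappa -> -1 < rho < 1 -> 0 < gamma_bar kappa rho.
Proof.
intros Hk Hr. unfold gamma_bar.
set (W := 2 * kappa ^ 2 + (1 - 2 * kappa) * (1 + rho)).
assert (H2 : 0 < sqrt 2) by (apply sqrt_lt_R0; lra).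
replace (sqrt W / (sqrt 2 * kappa * (1 - rho)) - (1 - 2 * kappa + rho) / (2 * kappa * (1 - rho)))
  with ((sqrt 2 * sqrt W - (1 - 2 * kappa + rho)) / (2 * kappa * (1 - rho))).
2: { transitivity (sqrt 2 * sqrt W / (sqrt 2 * sqrt 2 * kappa * (1 - rho))
       - (1 - 2 * kappa + rho) / (2 * kappa * (1 - rho))).
     - rewrite sqrt_sqrt by lra. field. repeat split; lra.
     - f_equal. field. repeat split; lra. }
apply Rdiv_lt_0_compat; [| apply Rmult_lt_0_compat; lra].
rewrite <- sqrt_mult_alt by lra.
apply Rlt_0_minus. destruct (Rlt_le_dec (1 - 2 * kappa + rho) 0) as [Hn | Hn].
- eapply Rlt_le_trans; [exact Hn | apply sqrt_pos].
- rewrite <- (sqrt_pow2 (1 - 2 * kappa + rho)) by exact Hn.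
  apply sqrt_lt_1_alt. split; [apply pow2_ge_0 | unfold W; nra].
Qed.

Lemma riccati_Delta_gamma_bar (kappa rho : R) :
  0 < kappa -> -1 < rho < 1 -> riccati_Delta kappa rho (gamma_bar kappa rho) = 0.
Proof.
intros Hk Hr. unfold riccati_Delta, gamma_bar.
set (W := 2 * kappa ^ 2 + (1 - 2 * kappa) * (1 + rho)).
assert (HW : 0 <= W).
{ unfold W. replace (2 * kappa ^ 2 + (1 - 2 * kappa) * (1 + rho)) with
  (2 * (kappa - (1 + rho) / 2) ^ 2 + (1 + rho) * (1 - rho) / 2) by field.
  assert (H := pow2_ge_0 (kappa - (1 + rho) / 2)). nra. }
assert (H2 : 0 < sqrt 2) by (apply sqrt_lt_R0; lra).
assert (HS : sqrt W ^ 2 = W) by (apply pow2_sqrt, HW).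
assert (HS2 : sqrt 2 ^ 2 = 2) by (apply pow2_sqrt; lra).
(* In terms of [q] the two roots disappear: the terms linear in [q] cancel and Delta becomes a
   multiple of W/2 - q^2 = 0. *)
set (q := sqrt W / sqrt 2).
assert (Hq : q ^ 2 = W / 2).
{ unfold q. transitivity (sqrt W ^ 2 / sqrt 2 ^ 2); [field; lra | now rewrite HS, HS2]. }
replace (sqrt W / (sqrt 2 * kappa * (1 - rho))) with (q / (kappa * (1 - rho)))
  by (unfold q; field; repeat split; lra).
replace ((rho - 1) / (rho + 1) * kappa ^ 2 *
  (q / (kappa * (1 - rho)) - (1 - 2 * kappa + rho) / (2 * kappa * (1 - rho))) ^ 2 +
  (2 * kappa / (1 + rho) - 1) * kappa *
  (q / (kappa * (1 - rho)) - (1 - 2 * kappa + rho) / (2 * kappa * (1 - rho))) + 1 / 4)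
with ((W / 2 - q ^ 2) / ((1 - rho) * (1 + rho))).
- rewrite Hq. unfold Rdiv; ring.
- unfold W. field. repeat split; lra.
Qed.

(* [Delta] is a concave quadratic with [Delta 0 = 1/4] and positive root [gamma_bar]. *)
Lemma riccati_Delta_factor (kappa rho gamma : R) :
  0 < kappa -> -1 < rho < 1 ->
  gamma_bar kappa rho * riccati_Delta kappa rho gamma
  = (gamma_bar kappa rho - gamma)
    * (1 / 4 + (1 - rho) / (1 + rho) * kappa ^ 2 * gamma * gamma_bar kappa rho).
Proof.
intros Hk Hr. assert (H := riccati_Delta_gamma_bar kappa rho Hk Hr).
set (b := gamma_bar kappa rho) in *.
(* Subtracting gamma Delta(b) = 0 removes the terms in b gamma, so that b - gamma factors out. *)
transitivity (b * riccati_Delta kappa rho gamma - gamma * riccati_Delta kappa rho b);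
  [rewrite H; ring |].
unfold riccati_Delta. field. lra.
Qed.

Lemma riccati_Delta_factor_pos (kappa rho gamma : R) :
  0 < kappa -> -1 < rho < 1 -> 0 <= gamma ->
  0 < 1 / 4 + (1 - rho) / (1 + rho) * kappa ^ 2 * gamma * gamma_bar kappa rho.
Proof.
intros Hk Hr Hg. assert (Hb := gamma_bar_pos kappa rho Hk Hr).
assert (0 <= (1 - rho) / (1 + rho) * kappa ^ 2 * gamma * gamma_bar kappa rho); [| lra].
assert (0 < (1 - rho) / (1 + rho)) by (apply Rdiv_lt_0_compat; lra).
apply Rmult_le_pos; [| lra]. apply Rmult_le_pos; [| lra].
apply Rmult_le_pos; [lra | apply pow2_ge_0].
Qed.

Lemma riccati_Delta_neg_iff (kappa rho gamma : R) :
  0 < kappa -> -1 < rho < 1 -> 0 <= gamma ->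
  riccati_Delta kappa rho gamma < 0 <-> gamma_bar kappa rho < gamma.
Proof.
intros Hk Hr Hg. assert (Hb := gamma_bar_pos kappa rho Hk Hr).
assert (Hf := riccati_Delta_factor kappa rho gamma Hk Hr).
assert (Hp := riccati_Delta_factor_pos kappa rho gamma Hk Hr Hg).
split; intros H.
- apply Rnot_le_lt; intros Hn. nra.
- apply Rnot_le_lt; intros Hn. nra.
Qed.

Lemma riccati_Delta_pos (kappa rho gamma : R) :
  0 < kappa -> -1 < rho < 1 -> 0 <= gamma < gamma_bar kappa rho ->
  0 < riccati_Delta kappa rho gamma.
Proof.
intros Hk Hr Hg. assert (Hb := gamma_bar_pos kappa rho Hk Hr).
assert (Hf := riccati_Delta_factor kappa rho gamma Hk Hr).
assert (Hp := riccati_Delta_factor_pos kappa rho gamma Hk Hr (proj1 Hg)).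
apply Rnot_le_lt; intros Hn. nra.
Qed.

(** Delta(1) = (1/2 - kappa)^2 is not negative, so 1 cannot lie beyond the root. *)
Lemma gamma_bar_ge_1 (kappa rho : R) :
  0 < kappa -> -1 < rho < 1 -> 1 <= gamma_bar kappa rho.
Proof.
intros Hk Hr. apply Rnot_lt_le; intros Hn.
apply riccati_Delta_neg_iff in Hn; try lra.
rewrite riccati_Delta_square in Hn by lra.
assert (H := pow2_ge_0 (1 / 2 - 1 * kappa)).
unfold Rdiv in Hn. nra.
Qed.

(** At gamma = 1/(2 kappa) > 1 the square in Delta vanishes and the remaining term is negative, so
    this point lies beyond the root. Consequently a = 1/2 - gamma kappa is positive for all gamma up
    to [gamma_bar]. *)
Lemma half_kappa_gamma_bar (kappa rho : R) :
  0 < kappa < 1 / 2 -> -1 < rho < 1 -> gamma_bar kappa rho * kappa < 1 / 2.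
Proof.
intros Hk Hr.
assert (Hg : 1 < / (2 * kappa)).
{ rewrite <- Rinv_1. apply Rinv_lt_contravar; lra. }
assert (H : gamma_bar kappa rho < / (2 * kappa)).
{ apply (riccati_Delta_neg_iff kappa rho (/ (2 * kappa))); try lra.
  rewrite riccati_Delta_square by lra.
  replace (1 / 2 - / (2 * kappa) * kappa) with 0 by (field; lra).
  assert (0 < 2 * kappa ^ 2 * / (2 * kappa) * (/ (2 * kappa) - 1) / (1 + rho)).
  { apply Rdiv_lt_0_compat; [| lra]. repeat apply Rmult_lt_0_compat; lra. }
  unfold Rdiv in *; lra. }
apply (Rmult_lt_compat_r kappa) in H; [| lra].
replace (/ (2 * kappa) * kappa) with (1 / 2) in H by (field; lra). exact H.
Qed.

(** Equality is impossible because Delta(1) = (1/2 - kappa)^2 > 0 while Delta vanishes at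
    [gamma_bar]. *)
Lemma gamma_bar_gt_1 (kappa rho : R) :
  0 < kappa < 1 / 2 -> -1 < rho < 1 -> 1 < gamma_bar kappa rho.
Proof.
intros Hk Hr.
assert (H1 := gamma_bar_ge_1 kappa rho (proj1 Hk) Hr).
destruct H1 as [| H1]; [assumption | exfalso].
assert (H := riccati_Delta_gamma_bar kappa rho (proj1 Hk) Hr).
rewrite <- H1, riccati_Delta_square in H by lra.
assert (0 < (1 / 2 - 1 * kappa) ^ 2) by (apply pow2_gt_0; lra).
unfold Rdiv in *; nra.
Qed.

(** * Escape and blow-up at a zero of the linear solution *)

Lemma riccati_linearization_invariant (a D : R) (f g : R -> R) (u : R) :
  riccati_linearization a D f g -> 0 < u ->
  g u ^ 2 - D * f u ^ 2 = a ^ 2 - D.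
Proof.
intros [Hf [Hg [Hf0 Hg0]]] Hu.
transitivity (g 0 ^ 2 - D * f 0 ^ 2); [| rewrite Hf0, Hg0; ring].
symmetry. apply (eq_is_derive (fun u => g u ^ 2 - D * f u ^ 2)); [| exact Hu].
intros t _. assert (Hft := Hf t). assert (Hgt := Hg t).
auto_derive; [repeat split; eexists; eassumption |].
replace (Derive (fun x => f x) t) with (g t)
  by (symmetry; apply is_derive_unique, Hft).
replace (Derive (fun x => g x) t) with (D * f t)
  by (symmetry; apply is_derive_unique, Hgt).
unfold zero; simpl. ring.
Qed.

Lemma riccati_linearization_derivative_at_zero (kappa rho gamma : R) (f g : R -> R) (us : R) :
  0 < kappa -> -1 < rho < 1 -> 1 < gamma -> 0 < us ->
  riccati_linearization (1 / 2 - gamma * kappa) (riccati_Delta kappa rho gamma) f g ->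
  f us = 0 -> g us <> 0.
Proof.
intros Hk Hr Hg Hus Hlin Hf0 Hg0.
assert (H := riccati_linearization_invariant _ _ _ _ _ Hlin Hus).
rewrite riccati_Delta_square, Hf0, Hg0 in H by lra.
assert (0 < 2 * kappa ^ 2 * gamma * (gamma - 1) / (1 + rho)).
{ apply Rdiv_lt_0_compat; [| lra]. repeat apply Rmult_lt_0_compat; lra. }
unfold Rdiv in *; nra.
Qed.

Lemma log_time_exp (eps us : R) :
  0 < eps -> ln (1 + eps * (exp us - 1) / eps) = us.
Proof.
intros He. replace (1 + eps * (exp us - 1) / eps) with (exp us) by (field; lra).
apply ln_exp.
Qed.

Lemma log_time_bounds (eps T t : R) :
  0 < eps -> 0 <= t <= T ->
  0 <= ln (1 + (T - t) / eps) <= ln (1 + T / eps).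
Proof.
intros He Ht.
assert (0 <= (T - t) / eps) by (apply Rdiv_le_0_compat; lra).
assert ((T - t) / eps <= T / eps)
  by (apply Rmult_le_compat_r; [apply Rlt_le, Rinv_0_lt_compat |]; lra).
split; [rewrite <- ln_1 |]; apply ln_le; lra.
Qed.

Lemma log_time_lt (eps T us : R) :
  0 < eps -> 0 < T -> T < eps * (exp us - 1) -> ln (1 + T / eps) < us.
Proof.
intros He HT H.
rewrite <- (log_time_exp eps us He).
assert (0 < T / eps) by (apply Rdiv_lt_0_compat; lra).
assert (T / eps < eps * (exp us - 1) / eps)
  by (apply Rmult_lt_compat_r; [apply Rinv_0_lt_compat |]; lra).
apply ln_increasing; lra.
Qed.

(** Otherwise t = T - eps (exp us - 1) lies in [0, T] and corresponds to u = us. There g + y f = 0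
    reduces to g(us) = 0, which the invariant excludes. *)
Lemma riccati_solution_before_zero (eps kappa rho gamma us : R) (f g : R -> R) :
  0 < eps -> 0 < kappa -> -1 < rho < 1 -> 1 < gamma -> 0 < us ->
  riccati_linearization (1 / 2 - gamma * kappa) (riccati_Delta kappa rho gamma) f g ->
  f us = 0 ->
  forall T, 0 < T ->
    (exists h, riccati_solution eps kappa rho gamma T h) -> T < eps * (exp us - 1).
Proof.
intros He Hk Hr Hg Hus Hlin Hf0 T HT [h Hh].
apply Rnot_le_lt; intros Hn.
assert (H1 : 0 < exp us - 1) by (rewrite <- exp_0 at 1; apply Rlt_0_minus, exp_increasing, Hus).
assert (HTs : 0 < eps * (exp us - 1)) by (apply Rmult_lt_0_compat; lra).
assert (H := riccati_solution_linearized _ _ _ _ _ _ _ _ He Hr HT Hlin Hh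
  (T - eps * (exp us - 1)) ltac:(lra)).
simpl in H.
replace (T - (T - eps * (exp us - 1))) with (eps * (exp us - 1)) in H by ring.
rewrite log_time_exp, Hf0 in H by exact He.
apply (riccati_linearization_derivative_at_zero kappa rho gamma f g us); trivial. lra.
Qed.

(** At t = 0 the linearized identity reads c(T) H(T, 0) f(u(T)) = -(g(u(T)) + a f(u(T))). As T
    increases to Tstar, f(u(T)) tends to 0 and the right-hand side to -g(us), which is nonzero. *)
Lemma riccati_solution_blow_up (eps kappa rho gamma us : R) (f g : R -> R) (H : R -> R -> R) :
  0 < eps -> 0 < kappa -> -1 < rho < 1 -> 1 < gamma -> 0 < us ->
  riccati_linearization (1 / 2 - gamma * kappa) (riccati_Delta kappa rho gamma) f g ->
  f us = 0 ->
  let Tstar := eps * (exp us - 1) in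
  (forall T, 0 < T < Tstar -> riccati_solution eps kappa rho gamma T (H T)) ->
  filterlim (fun T => Rabs (H T 0)) (at_left Tstar) (Rbar_locally p_infty).
Proof.
intros He Hk Hr Hg Hus Hlin Hf0 Tstar HH P [M HM].
set (a := 1 / 2 - gamma * kappa) in *.
set (u := fun T => ln (1 + T / eps)).
set (c := fun T => 2 * gamma * (1 - rho) * (T + eps)).
assert (H1 : 0 < exp us - 1) by (rewrite <- exp_0 at 1; apply Rlt_0_minus, exp_increasing, Hus).
assert (HTs : 0 < Tstar) by (apply Rmult_lt_0_compat; lra).
(* [Rabs (H T 0) > M] amounts to [phi T > 0], and [phi Tstar = Rabs (g us) > 0]. *)
set (phi := fun T => Rabs (g (u T) + a * f (u T)) - Rmax M 0 * Rabs (f (u T)) * c T).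
assert (Hu : continuous u Tstar).
{ apply (ex_derive_continuous u). unfold u. auto_derive.
  assert (0 < Tstar * / eps) by (apply Rmult_lt_0_compat; [| apply Rinv_0_lt_compat]; lra).
  lra. }
assert (Hfu : continuous (fun T => f (u T)) Tstar).
{ apply (continuous_comp u f); [exact Hu |].
  apply (ex_derive_continuous f). eexists; apply (proj1 Hlin). }
assert (Hgu : continuous (fun T => g (u T)) Tstar).
{ apply (continuous_comp u g); [exact Hu |].
  apply (ex_derive_continuous g). eexists; apply (proj1 (proj2 Hlin)). }
assert (Hphi : continuous phi Tstar).
{ apply (continuous_minus (fun T => Rabs (g (u T) + a * f (u T)))
           (fun T => Rmax M 0 * Rabs (f (u T)) * c T)).
  - apply (continuous_comp (fun T => g (u T) + a * f (u T)) Rabs);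
      [| apply continuous_Rabs].
    apply (continuous_plus (fun T => g (u T)) (fun T => a * f (u T))); [exact Hgu |].
    apply (continuous_scal_r a (fun T => f (u T))), Hfu.
  - apply (continuous_mult (fun T => Rmax M 0 * Rabs (f (u T))) c).
    + apply (continuous_scal_r (Rmax M 0) (fun T => Rabs (f (u T)))).
      apply (continuous_comp (fun T => f (u T)) Rabs); [exact Hfu | apply continuous_Rabs].
    + apply (ex_derive_continuous c). unfold c. auto_derive; trivial. }
assert (Hpos : 0 < phi Tstar).
{ unfold phi, u, Tstar. rewrite log_time_exp, Hf0, Rabs_R0 by exact He.
  assert (Hn := riccati_linearization_derivative_at_zero kappa rho gamma f g us Hk Hr Hg Hus Hlin Hf0).
  assert (Hp := Rabs_pos_lt (g us) Hn).
  replace (g us + a * 0) with (g us) by ring. lra. }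
assert (Hloc : locally Tstar (fun T => 0 < phi T)).
{ apply (Hphi (fun y => 0 < y)). apply (open_gt 0 (phi Tstar) Hpos). }
assert (Hloc0 : locally Tstar (fun T => 0 < T)) by (apply (open_gt 0 Tstar HTs)).
unfold filtermap, at_left, within.
generalize (filter_and _ _ Hloc Hloc0). apply filter_imp.
intros T [HpT HT0] HTT. apply HM.
assert (E := riccati_solution_linearized _ _ _ _ _ _ _ _ He Hr HT0 Hlin
  (HH T (conj HT0 HTT)) 0 ltac:(lra)).
simpl in E. rewrite Rminus_0_r in E.
fold (u T) a (c T) in E. unfold phi in HpT.
assert (Hc : 0 < c T) by (unfold c; repeat apply Rmult_lt_0_compat; lra).
replace (g (u T) + a * f (u T)) with (- (c T * H T 0 * f (u T))) in HpT by lra.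
rewrite Rabs_Ropp, 2!Rabs_mult, (Rabs_right (c T)) in HpT by lra.
assert (Hf := Rabs_pos (f (u T))).
apply Rle_lt_trans with (1 := Rmax_l M 0).
apply Rnot_le_lt; intros Hn.
assert (c T * Rabs (f (u T)) * Rabs (H T 0) <= c T * Rabs (f (u T)) * Rmax M 0).
{ apply Rmult_le_compat_l; [apply Rmult_le_pos; lra | exact Hn]. }
lra.
Qed.

(** * The escape time in the form eps (exp us - 1) *)

(** The exponent is the value of u at which the angle d u + arctan(a/d) reaches pi/2, where a/d = (1
    - 2 gamma kappa) / (2 d). *)
Lemma escape_time_supercritical (eps kappa rho gamma : R) :
  gamma > gamma_bar kappa rho ->
  let d := sqrt (- riccati_Delta kappa rho gamma) in
  escape_time eps kappa rho gamma
  = Finite (eps * (exp ((PI / 2 - atan ((1 - 2 * gamma * kappa) / (2 * d))) / d) - 1)).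
Proof.
intros H d. unfold escape_time.
destruct (excluded_middle_informative _) as [_ | Hn]; [fold d | contradiction].
replace (PI / (2 * d) - 1 / d * atan ((1 - 2 * gamma * kappa) / (2 * d)))
  with ((PI / 2 - atan ((1 - 2 * gamma * kappa) / (2 * d))) / d); [reflexivity |].
unfold Rdiv. rewrite (Rinv_mult 2 d). ring.
Qed.

Lemma escape_time_critical (eps kappa rho : R) :
  0 < kappa < 1 / 2 ->
  escape_time eps kappa rho (gamma_bar kappa rho)
  = Finite (eps * (exp (2 / (1 - 2 * gamma_bar kappa rho * kappa)) - 1)).
Proof.
intros H. unfold escape_time.
destruct (excluded_middle_informative _) as [Hn | _]; [lra |].
destruct (excluded_middle_informative _) as [_ | Hn]; [reflexivity | tauto].
Qed.

(** The exponent is the value of u at which (d - a) exp(2 d u) + (d + a) vanishes. *)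
Lemma escape_time_subcritical (eps kappa rho gamma : R) :
  1 < gamma < gamma_bar kappa rho -> 0 < kappa < 1 / 2 ->
  let d := sqrt (riccati_Delta kappa rho gamma) in
  let a := 1 / 2 - gamma * kappa in
  escape_time eps kappa rho gamma
  = Finite (eps * (exp (ln ((a + d) / (a - d)) / (2 * d)) - 1)).
Proof.
intros Hg Hk d a. unfold escape_time.
destruct (excluded_middle_informative _) as [Hn | _]; [lra |].
destruct (excluded_middle_informative _) as [Hn | _]; [lra |].
destruct (excluded_middle_informative _) as [_ | Hn]; [| tauto].
fold d a. unfold Rpower.
now replace (1 / (2 * d) * ln ((a + d) / (a - d))) with (ln ((a + d) / (a - d)) / (2 * d))
  by (unfold Rdiv; ring).
Qed.

Lemma escape_time_infinite (eps kappa rho gamma : R) :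
  gamma <= gamma_bar kappa rho -> gamma <= 1 \/ 1 / 2 <= kappa ->
  0 < kappa -> -1 < rho < 1 ->
  escape_time eps kappa rho gamma = p_infty.
Proof.
intros Hg H Hk Hr. unfold escape_time.
destruct (excluded_middle_informative _) as [Hn | _]; [lra |].
(* The critical clause requires kappa < 1/2, where [gamma_bar] exceeds 1, against the second
   hypothesis. *)
destruct (excluded_middle_informative _) as [[-> Hn] | _].
{ assert (H1 := gamma_bar_gt_1 kappa rho Hn Hr). lra. }
destruct (excluded_middle_informative _) as [Hn | _]; [lra | reflexivity].
Qed.

(** Common interface of the three regimes: the first positive zero of [f], if any, is the escape
    time in the variable u. The clause [1 < gamma] is what makes the derivative nonzero there. *)
Definition positive_until_escape (eps kappa rho gamma : R) (f : R -> R) : Prop :=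
  (escape_time eps kappa rho gamma = p_infty /\ forall u, 0 <= u -> 0 < f u) \/
  (1 < gamma /\ exists us, 0 < us /\ f us = 0 /\ (forall u, 0 <= u < us -> 0 < f u) /\
     escape_time eps kappa rho gamma = Finite (eps * (exp us - 1))).

Lemma positive_before_escape (eps kappa rho gamma T : R) (f : R -> R) :
  0 < eps -> positive_until_escape eps kappa rho gamma f -> 0 < T ->
  Rbar_lt T (escape_time eps kappa rho gamma) ->
  forall t, 0 <= t <= T -> 0 < f (ln (1 + (T - t) / eps)).
Proof.
intros He Hf HT HTs t Ht. assert (Hb := log_time_bounds eps T t He Ht).
destruct Hf as [[_ Hf] | [_ [us [_ [_ [Hf E]]]]]]; apply Hf; [lra |].
rewrite E in HTs. assert (H := log_time_lt eps T us He HT HTs). lra.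
Qed.

(** * Explicit linear solutions and their first zeros *)

(** Solutions for Delta = -d^2, 0, d^2. The first is cos(d u) - (a/d) sin(d u) in phase form, so
    that -g/f = d tan(d u + arctan(a/d)); the last is cosh(d u) - (a/d) sinh(d u). *)
Definition supercritical_f (a d u : R) : R := cos (d * u + atan (a / d)) / cos (atan (a / d)).
Definition supercritical_g (a d u : R) : R :=
  - d * sin (d * u + atan (a / d)) / cos (atan (a / d)).
Definition critical_f (a u : R) : R := 1 - a * u.
Definition critical_g (a u : R) : R := - a.
Definition subcritical_f (a d u : R) : R :=
  ((d - a) * exp (d * u) + (d + a) * exp (- (d * u))) / (2 * d).
Definition subcritical_g (a d u : R) : R :=
  ((d - a) * exp (d * u) - (d + a) * exp (- (d * u))) / 2.

Lemma cos_atan_pos (x : R) : 0 < cos (atan x).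
Proof. destruct (atan_bound x). apply cos_gt_0; lra. Qed.

Lemma supercritical_linearization (a d : R) :
  0 < d -> riccati_linearization a (- d ^ 2) (supercritical_f a d) (supercritical_g a d).
Proof.
intros Hd. assert (Hc := cos_atan_pos (a / d)).
split; [| split; [| split]]; intros; unfold supercritical_f, supercritical_g.
- auto_derive; [trivial | field; lra].
- auto_derive; [trivial | field; lra].
- replace (d * 0 + atan (a / d)) with (atan (a / d)) by ring. field. lra.
- replace (d * 0 + atan (a / d)) with (atan (a / d)) by ring.
  transitivity (- d * tan (atan (a / d))); [unfold tan; field; lra |].
  rewrite tan_atan. field. lra.
Qed.

Lemma critical_linearization (a : R) :
  riccati_linearization a 0 (critical_f a) (critical_g a).
Proof.
split; [| split; [| split]]; intros; unfold critical_f, critical_g; [| | ring | ring].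
- auto_derive; [trivial | ring].
- auto_derive; [trivial | ring].
Qed.

Lemma subcritical_linearization (a d : R) :
  0 < d -> riccati_linearization a (d ^ 2) (subcritical_f a d) (subcritical_g a d).
Proof.
intros Hd. split; [| split; [| split]]; intros; unfold subcritical_f, subcritical_g.
- auto_derive; [trivial | field; lra].
- auto_derive; [trivial | field; lra].
- rewrite Rmult_0_r, Ropp_0, exp_0. field. lra.
- rewrite Rmult_0_r, Ropp_0, exp_0. field.
Qed.

(** The angle d u + arctan(a/d) starts inside (-pi/2, pi/2) and increases, so the cosine stays
    positive until the angle reaches pi/2. *)
Lemma supercritical_positive (eps kappa rho gamma : R) :
  0 < kappa -> -1 < rho < 1 -> gamma > gamma_bar kappa rho ->
  positive_until_escape eps kappa rho gamma
    (supercritical_f (1 / 2 - gamma * kappa) (sqrt (- riccati_Delta kappa rho gamma))).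
Proof.
intros Hk Hr Hg. right.
assert (H1 := gamma_bar_ge_1 kappa rho Hk Hr).
split; [lra |].
assert (HD : riccati_Delta kappa rho gamma < 0) by (apply riccati_Delta_neg_iff; lra).
rewrite (escape_time_supercritical eps kappa rho gamma Hg).
assert (Hd : 0 < sqrt (- riccati_Delta kappa rho gamma)) by (apply sqrt_lt_R0; lra).
set (d := sqrt (- riccati_Delta kappa rho gamma)) in *.
set (a := 1 / 2 - gamma * kappa).
replace ((1 - 2 * gamma * kappa) / (2 * d)) with (a / d) by (unfold a; field; lra).
assert (Hc := cos_atan_pos (a / d)).
assert (Hb := atan_bound (a / d)).
exists ((PI / 2 - atan (a / d)) / d).
split; [| split; [| split; [| reflexivity]]].
- apply Rdiv_lt_0_compat; lra.
- unfold supercritical_f.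
  replace (d * ((PI / 2 - atan (a / d)) / d) + atan (a / d)) with (PI / 2) by (field; lra).
  rewrite cos_PI2. unfold Rdiv; ring.
- intros u Hu. unfold supercritical_f.
  assert (d * u < PI / 2 - atan (a / d)).
  { replace (PI / 2 - atan (a / d)) with (d * ((PI / 2 - atan (a / d)) / d)) by (field; lra).
    apply Rmult_lt_compat_l; lra. }
  assert (0 <= d * u) by (apply Rmult_le_pos; lra).
  apply Rdiv_lt_0_compat; [apply cos_gt_0; lra | exact Hc].
Qed.

(** For kappa < 1/2 the slope has a > 0, and 1 - a u first vanishes at 1/a. For kappa >= 1/2,
    [gamma_bar] >= 1 forces a <= 0 and there is no zero. *)
Lemma critical_positive (eps kappa rho : R) :
  0 < kappa -> -1 < rho < 1 ->
  positive_until_escape eps kappa rho (gamma_bar kappa rho)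
    (critical_f (1 / 2 - gamma_bar kappa rho * kappa)).
Proof.
intros Hk Hr. unfold critical_f.
destruct (Rlt_le_dec kappa (1 / 2)) as [Hk2 | Hk2].
- right. split; [apply gamma_bar_gt_1; lra |].
  assert (Ha := half_kappa_gamma_bar kappa rho (conj Hk Hk2) Hr).
  rewrite (escape_time_critical eps kappa rho (conj Hk Hk2)).
  set (a := 1 / 2 - gamma_bar kappa rho * kappa).
  assert (0 < a) by (unfold a; lra).
  replace (2 / (1 - 2 * gamma_bar kappa rho * kappa)) with (/ a)
    by (unfold a in *; field; lra).
  exists (/ a). split; [| split; [| split; [| reflexivity]]].
  + apply Rinv_0_lt_compat; lra.
  + field; lra.
  + intros u Hu. assert (a * u < a * / a) by (apply Rmult_lt_compat_l; lra).
    rewrite Rinv_r in * by lra. lra.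
- left. assert (H1 := gamma_bar_ge_1 kappa rho Hk Hr).
  split; [apply escape_time_infinite; lra |].
  intros u Hu. assert (1 / 2 <= gamma_bar kappa rho * kappa) by nra. nra.
Qed.

(** A positive factor turns [f] into an affine function of exp(2 d u), from which signs and zeros
    can be read off; it is also the denominator of the closed form. *)
Lemma subcritical_f_exp (a d u : R) :
  0 < d -> subcritical_f a d u * (2 * d * exp (d * u)) = (d - a) * exp (2 * d * u) + (d + a).
Proof.
intros Hd. unfold subcritical_f.
replace (2 * d * u) with (d * u + d * u) by ring.
rewrite exp_plus, exp_Ropp. assert (H := exp_pos (d * u)). field. lra.
Qed.

(** The order of [a] and [d] decides, through d^2 - a^2 = 2 kappa^2 gamma (1 - gamma) / (1 + rho).
    If gamma <= 1 then a <= d; if gamma > 1 and kappa >= 1/2 then a <= 0 < d; in both cases there is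
    no zero. If gamma > 1 and kappa < 1/2 then 0 < d < a, and there is exactly one. *)
Lemma subcritical_positive (eps kappa rho gamma : R) :
  0 < kappa -> -1 < rho < 1 -> 0 < gamma < gamma_bar kappa rho ->
  positive_until_escape eps kappa rho gamma
    (subcritical_f (1 / 2 - gamma * kappa) (sqrt (riccati_Delta kappa rho gamma))).
Proof.
intros Hk Hr Hg.
assert (HD : 0 < riccati_Delta kappa rho gamma) by (apply riccati_Delta_pos; lra).
assert (Hd : 0 < sqrt (riccati_Delta kappa rho gamma)) by (apply sqrt_lt_R0; lra).
assert (Hd2 : sqrt (riccati_Delta kappa rho gamma) ^ 2 = riccati_Delta kappa rho gamma)
  by (apply pow2_sqrt; lra).
assert (Esub := escape_time_subcritical eps kappa rho gamma).
assert (HDa := riccati_Delta_square kappa rho gamma (proj1 Hr)).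
set (d := sqrt (riccati_Delta kappa rho gamma)) in *.
set (a := 1 / 2 - gamma * kappa) in *.
assert (Hq : 0 < 2 * kappa ^ 2 * gamma / (1 + rho)).
{ apply Rdiv_lt_0_compat; [| lra]. repeat apply Rmult_lt_0_compat; lra. }
assert (Hda : d ^ 2 = a ^ 2 + 2 * kappa ^ 2 * gamma / (1 + rho) * (1 - gamma)).
{ rewrite Hd2, HDa. field. lra. }
(* As exp(2 d u) >= 1, the affine expression is at least (d - a) + (d + a) = 2 d > 0. *)
assert (Hlow : a <= d -> forall u, 0 <= u -> 0 < subcritical_f a d u).
{ intros Hle u Hu.
  apply Rmult_lt_reg_r with (2 * d * exp (d * u));
    [assert (H := exp_pos (d * u)); repeat apply Rmult_lt_0_compat; lra |].
  rewrite Rmult_0_l, subcritical_f_exp by exact Hd.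
  assert (1 <= exp (2 * d * u)).
  { assert (H := exp_ineq1_le (2 * d * u)).
    assert (0 <= 2 * d * u) by (repeat apply Rmult_le_pos; lra). lra. }
  nra. }
destruct (Rle_lt_dec gamma 1) as [Hg1 | Hg1].
- left. split; [apply escape_time_infinite; lra |]. apply Hlow.
  apply Rnot_lt_le; intros Hn. nra.
- destruct (Rlt_le_dec kappa (1 / 2)) as [Hk2 | Hk2].
  + right. split; [exact Hg1 |].
    assert (Hk3 := half_kappa_gamma_bar kappa rho (conj Hk Hk2) Hr).
    assert (Ha : 0 < a) by (unfold a; nra).
    assert (Had : d < a) by (apply Rnot_le_lt; intros Hn; nra).
    assert (Hx : 1 < (a + d) / (a - d)).
    { apply Rmult_lt_reg_r with (a - d); [lra |].
      unfold Rdiv; rewrite Rmult_assoc, Rinv_l by lra. lra. }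
    simpl in Esub; rewrite Esub by lra.
    assert (Hl : 0 < ln ((a + d) / (a - d)))
      by (rewrite <- ln_1; apply ln_increasing; lra).
    set (us := ln ((a + d) / (a - d)) / (2 * d)).
    assert (Hus : exp (2 * d * us) = (a + d) / (a - d)).
    { unfold us. replace (2 * d * (ln ((a + d) / (a - d)) / (2 * d)))
        with (ln ((a + d) / (a - d))) by (field; lra).
      apply exp_ln; lra. }
    exists us. split; [| split; [| split; [| reflexivity]]].
    * apply Rdiv_lt_0_compat; lra.
    * apply Rmult_eq_reg_r with (2 * d * exp (d * us));
        [| assert (H := exp_pos (d * us)); apply Rgt_not_eq;
           repeat apply Rmult_lt_0_compat; lra].
      rewrite subcritical_f_exp, Hus by exact Hd. field. lra.
    * intros u Hu.
      apply Rmult_lt_reg_r with (2 * d * exp (d * u));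
        [assert (H := exp_pos (d * u)); repeat apply Rmult_lt_0_compat; lra |].
      rewrite Rmult_0_l, subcritical_f_exp by exact Hd.
      assert (H : exp (2 * d * u) < exp (2 * d * us))
        by (apply exp_increasing, Rmult_lt_compat_l; lra).
      rewrite Hus in H. apply (Rmult_lt_compat_r (a - d)) in H; [| lra].
      replace ((a + d) / (a - d) * (a - d)) with (a + d) in H by (field; lra). lra.
  + left. split; [apply escape_time_infinite; lra |]. apply Hlow.
    assert (a <= 0) by (unfold a; nra). lra.
Qed.

Lemma riccati_linearization_exists (eps kappa rho gamma : R) :
  0 < kappa -> -1 < rho < 1 -> 0 < gamma ->
  exists f g,
    riccati_linearization (1 / 2 - gamma * kappa) (riccati_Delta kappa rho gamma) f g /\
    positive_until_escape eps kappa rho gamma f.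
Proof.
intros Hk Hr Hg.
destruct (Rtotal_order gamma (gamma_bar kappa rho)) as [H | [H | H]].
- assert (HD := riccati_Delta_pos kappa rho gamma Hk Hr ltac:(lra)).
  do 2 eexists. split; [| apply subcritical_positive; auto].
  rewrite <- (pow2_sqrt (riccati_Delta kappa rho gamma)) at 1 by lra.
  apply subcritical_linearization, sqrt_lt_R0, HD.
- rewrite H, riccati_Delta_gamma_bar by lra.
  do 2 eexists. split; [apply critical_linearization | apply critical_positive; trivial].
- assert (HD := proj2 (riccati_Delta_neg_iff kappa rho gamma Hk Hr ltac:(lra)) H).
  do 2 eexists. split; [| apply supercritical_positive; trivial].
  rewrite <- (Ropp_involutive (riccati_Delta kappa rho gamma)) at 1.
  rewrite <- (pow2_sqrt (- riccati_Delta kappa rho gamma)) at 1 by lra.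
  apply supercritical_linearization, sqrt_lt_R0; lra.
Qed.

(** * Closed forms of the Riccati solution *)

Lemma is_unique_riccati_solution_supercritical (eps kappa rho gamma T : R) :
  0 < eps -> 0 < kappa -> -1 < rho < 1 -> gamma > gamma_bar kappa rho ->
  0 < T -> Rbar_lt T (escape_time eps kappa rho gamma) ->
  is_unique_riccati_solution eps kappa rho gamma T (h_supercritical eps kappa rho gamma T).
Proof.
intros He Hk Hr Hg HT HTs.
assert (Hb := gamma_bar_pos kappa rho Hk Hr).
assert (HD := proj2 (riccati_Delta_neg_iff kappa rho gamma Hk Hr ltac:(lra)) Hg).
assert (Hd : 0 < sqrt (- riccati_Delta kappa rho gamma)) by (apply sqrt_lt_R0; lra).
assert (Hd2 : sqrt (- riccati_Delta kappa rho gamma) ^ 2 = - riccati_Delta kappa rho gamma)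
  by (apply pow2_sqrt; lra).
assert (Hf := positive_before_escape _ _ _ _ T _ He
  (supercritical_positive eps kappa rho gamma Hk Hr Hg) HT HTs).
assert (Hlin := supercritical_linearization (1 / 2 - gamma * kappa) _ Hd).
rewrite Hd2, Ropp_involutive in Hlin.
assert (Hg0 : 0 < gamma) by lra.
apply (is_unique_riccati_solution_linearized _ _ _ _ _ _ _ _ He Hr HT Hg0 Hlin).
- intros t Ht. apply Rgt_not_eq, Hf, Ht.
- intros t Ht. specialize (Hf t Ht). simpl. unfold h_supercritical.
  set (d := sqrt (- riccati_Delta kappa rho gamma)) in *.
  replace ((1 - 2 * gamma * kappa) / (2 * d)) with ((1 / 2 - gamma * kappa) / d)
    by (field; lra).
  unfold supercritical_f, supercritical_g in *.
  set (c := atan ((1 / 2 - gamma * kappa) / d)) in *.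
  assert (Hc : 0 < cos c) by apply cos_atan_pos.
  set (v := d * ln (1 + (T - t) / eps) + c) in *.
  assert (Hv : cos v <> 0).
  { intros E. rewrite E in Hf. unfold Rdiv in Hf. lra. }
  unfold tan. field. repeat split; lra.
Qed.

Lemma is_unique_riccati_solution_critical (eps kappa rho T : R) :
  0 < eps -> 0 < kappa -> -1 < rho < 1 ->
  0 < T -> Rbar_lt T (escape_time eps kappa rho (gamma_bar kappa rho)) ->
  is_unique_riccati_solution eps kappa rho (gamma_bar kappa rho) T
    (h_critical eps kappa rho (gamma_bar kappa rho) T).
Proof.
intros He Hk Hr HT HTs.
assert (Hb := gamma_bar_pos kappa rho Hk Hr).
assert (Hf := positive_before_escape _ _ _ _ T _ He
  (critical_positive eps kappa rho Hk Hr) HT HTs).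
assert (Hlin := critical_linearization (1 / 2 - gamma_bar kappa rho * kappa)).
rewrite <- (riccati_Delta_gamma_bar kappa rho Hk Hr) in Hlin.
apply (is_unique_riccati_solution_linearized _ _ _ _ _ _ _ _ He Hr HT Hb Hlin).
- intros t Ht. apply Rgt_not_eq, Hf, Ht.
- intros t Ht. specialize (Hf t Ht). simpl. unfold h_critical.
  unfold critical_f, critical_g in *.
  set (l := ln (1 + (T - t) / eps)) in *.
  set (a := 1 / 2 - gamma_bar kappa rho * kappa) in *.
  (* The identity behind this is -g/f - a = a / (1 - a l) - a = a^2 l / (1 - a l). *)
  field. repeat split; lra.
Qed.

Lemma is_unique_riccati_solution_subcritical (eps kappa rho gamma T : R) :
  0 < eps -> 0 < kappa -> -1 < rho < 1 -> 0 < gamma < gamma_bar kappa rho ->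
  0 < T -> Rbar_lt T (escape_time eps kappa rho gamma) ->
  is_unique_riccati_solution eps kappa rho gamma T (h_subcritical eps kappa rho gamma T).
Proof.
intros He Hk Hr Hg HT HTs.
assert (HD := riccati_Delta_pos kappa rho gamma Hk Hr ltac:(lra)).
assert (Hd : 0 < sqrt (riccati_Delta kappa rho gamma)) by (apply sqrt_lt_R0; lra).
assert (Hd2 : sqrt (riccati_Delta kappa rho gamma) ^ 2 = riccati_Delta kappa rho gamma)
  by (apply pow2_sqrt; lra).
assert (Hf := positive_before_escape _ _ _ _ T _ He
  (subcritical_positive eps kappa rho gamma Hk Hr Hg) HT HTs).
assert (Hlin := subcritical_linearization (1 / 2 - gamma * kappa) _ Hd).
rewrite Hd2 in Hlin.
assert (Hg0 : 0 < gamma) by lra.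
apply (is_unique_riccati_solution_linearized _ _ _ _ _ _ _ _ He Hr HT Hg0 Hlin).
- intros t Ht. apply Rgt_not_eq, Hf, Ht.
- intros t Ht. specialize (Hf t Ht). simpl. unfold h_subcritical.
  assert (Hsq := riccati_Delta_square kappa rho gamma (proj1 Hr)).
  set (d := sqrt (riccati_Delta kappa rho gamma)) in *.
  clearbody d.
  set (u := ln (1 + (T - t) / eps)) in *.
  assert (Hp : Rpower (1 + (T - t) / eps) (2 * d) = exp (d * u) * exp (d * u)).
  { unfold Rpower; fold u. rewrite <- exp_plus. f_equal. ring. }
  rewrite Hp.
  assert (HE := exp_pos (d * u)).
  assert (HfE := subcritical_f_exp (1 / 2 - gamma * kappa) d u Hd).
  replace (2 * d * u) with (d * u + d * u) in HfE by ring.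
  rewrite exp_plus in HfE.
  assert (Hden : 0 < (d - (1 / 2 - gamma * kappa)) * (exp (d * u) * exp (d * u))
                     + (d + (1 / 2 - gamma * kappa))).
  { rewrite <- HfE. apply Rmult_lt_0_compat; [exact Hf |]. repeat apply Rmult_lt_0_compat; lra. }
  set (a := 1 / 2 - gamma * kappa) in *.
  (* The stated prefactor hides a^2 - d^2, which is the numerator produced by -g/f - a. *)
  replace (kappa ^ 2 * (gamma - 1) / ((1 - rho ^ 2) * (T - t + eps)))
    with ((a ^ 2 - d ^ 2) / (2 * gamma * (1 - rho) * (T - t + eps)))
    by (rewrite Hd2, Hsq; unfold a; field; repeat split; try lra; nra).
  replace (d - 1 / 2 + gamma * kappa) with (d - a) by (unfold a; ring).
  replace ((d - a) * (exp (d * u) * exp (d * u)) + d + 1 / 2 - gamma * kappa)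
    with ((d - a) * (exp (d * u) * exp (d * u)) + (d + a)) by (unfold a; ring).
  unfold subcritical_f, subcritical_g. rewrite exp_Ropp.
  set (E := exp (d * u)) in *.
  field. repeat split; lra.
Qed.

Lemma is_unique_riccati_solution_zero (eps kappa rho T : R) :
  0 < eps -> -1 < rho < 1 -> 0 < T ->
  is_unique_riccati_solution eps kappa rho 0 T (h_zero eps kappa rho T).
Proof.
intros He Hr HT.
assert (Hder : forall t x, t <= T ->
  is_derive (h_zero eps kappa rho T) t (riccati_rhs eps kappa rho 0 T t x)).
{ intros t x Ht. unfold h_zero, riccati_rhs. auto_derive; [lra |].
  field. repeat split; try lra; nra. }
assert (HF : h_zero eps kappa rho T T = 0).
{ unfold h_zero. field. repeat split; try lra; nra. }
intros h. split.
- intros Hh t Ht.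
  destruct (riccati_solution_continuous_extension _ _ _ _ _ _ HT Hh)
    as [k [Hkh [Hkc [Hkd HkT]]]].
  rewrite <- (Hkh t Ht). apply Rminus_diag_uniq.
  apply (linear_ode_zero T (fun t => k t - h_zero eps kappa rho T t) (fun _ => 0));
    [| | | | exact Ht].
  + intros x Hx. apply (continuous_minus k (h_zero eps kappa rho T)); [apply Hkc, Hx |].
    apply (ex_derive_continuous (h_zero eps kappa rho T)).
    eexists; apply (Hder x 0); lra.
  + intros; apply continuous_const.
  + intros x Hx.
    replace (0 * (k x - h_zero eps kappa rho T x)) with
      (riccati_rhs eps kappa rho 0 T x (k x) - riccati_rhs eps kappa rho 0 T x (k x)) by ring.
    apply (is_derive_minus k (h_zero eps kappa rho T)); [apply Hkd, Hx | apply Hder; lra].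
  + rewrite HkT, HF. ring.
- intros Heq. apply riccati_solution_of_is_derive with (F := h_zero eps kappa rho T).
  + lra.
  + intros t Ht. apply Hder; lra.
  + exact HF.
  + exact Heq.
Qed.

(** * Assembly over all values of [gamma] *)

Theorem lemma3p1 (eps kappa rho gamma : R)
  (heps : 0 < eps) (hkappa : 0 < kappa) (hrho : Rabs rho < 1) (hgamma : 0 <= gamma) :
  (forall T, 0 < T ->
     (exists h : R -> R, riccati_solution eps kappa rho gamma T h) ->
     Rbar_lt T (escape_time eps kappa rho gamma))
  /\
  (gamma > gamma_bar kappa rho ->
     riccati_Delta kappa rho gamma < 0 /\
     forall T, 0 < T -> Rbar_lt T (escape_time eps kappa rho gamma) ->
       is_unique_riccati_solution eps kappa rho gamma T
         (h_supercritical eps kappa rho gamma T))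
  /\
  (0 <= gamma <= gamma_bar kappa rho ->
     riccati_Delta kappa rho gamma >= 0 /\
     forall T, 0 < T -> Rbar_lt T (escape_time eps kappa rho gamma) ->
       (gamma = 0 ->
          is_unique_riccati_solution eps kappa rho gamma T (h_zero eps kappa rho T)) /\
       (gamma = gamma_bar kappa rho ->
          is_unique_riccati_solution eps kappa rho gamma T
            (h_critical eps kappa rho gamma T)) /\
       (0 < gamma < gamma_bar kappa rho ->
          is_unique_riccati_solution eps kappa rho gamma T
            (h_subcritical eps kappa rho gamma T)))
  /\
  (forall Tstar : R, escape_time eps kappa rho gamma = Finite Tstar ->
     forall H : R -> R -> R,
       (forall T, 0 < T < Tstar -> riccati_solution eps kappa rho gamma T (H T)) ->
       filterlim (fun T => Rabs (H T 0)) (at_left Tstar) (Rbar_locally p_infty)).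
Proof.
apply Rabs_lt_between in hrho.
assert (Hb := gamma_bar_ge_1 kappa rho hkappa hrho).
(* Both the bound on [T] and the blow-up need only this dichotomy: an infinite escape time, which
   includes gamma = 0, or one given by a zero of a linear solution. *)
assert (Hcases : escape_time eps kappa rho gamma = p_infty \/
  1 < gamma /\ exists f g us,
    riccati_linearization (1 / 2 - gamma * kappa) (riccati_Delta kappa rho gamma) f g /\
    0 < us /\ f us = 0 /\
    escape_time eps kappa rho gamma = Finite (eps * (exp us - 1))).
{ destruct hgamma as [Hg | <-].
  - destruct (riccati_linearization_exists eps kappa rho gamma hkappa hrho Hg)
      as [f [g [Hlin [[E _] | [Hg1 [us [Hus [Hf [_ E]]]]]]]]].
    + now left.
    + right. split; [exact Hg1 |]. now exists f, g, us.
  - left. apply escape_time_infinite; lra. }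
split; [| split; [| split]].
- intros T HT Hh.
  destruct Hcases as [-> | [Hg [f [g [us [Hlin [Hus [Hf ->]]]]]]]]; [exact I |].
  now apply (riccati_solution_before_zero eps kappa rho gamma us f g).
- intros Hg. split; [apply riccati_Delta_neg_iff; assumption |].
  intros T HT HTs. now apply is_unique_riccati_solution_supercritical.
- intros Hg. split.
  { apply Rle_ge, Rnot_lt_le. intros Hn.
    apply riccati_Delta_neg_iff in Hn; lra. }
  intros T HT HTs. split; [| split].
  + intros ->. now apply is_unique_riccati_solution_zero.
  + intros E. rewrite E in HTs |- *. now apply is_unique_riccati_solution_critical.
  + intros Hg'. now apply is_unique_riccati_solution_subcritical.
- intros Tstar ETs H HH.
  destruct Hcases as [E | [Hg [f [g [us [Hlin [Hus [Hf E]]]]]]]];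
    rewrite E in ETs; [discriminate |].
  injection ETs as <-.
  now apply (riccati_solution_blow_up eps kappa rho gamma us f g).
Qed.
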